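(* Let $\mathfrak g$ be a complex reductive Lie algebra with Cartan subalgebra $\mathfrak h$ and a chosen system of simple roots. Let $P\subset U(\mathfrak g)$ be an $\mathrm{ad}(\mathfrak g)$-invariant subspace, $P_0$ the zero weight space of $P$ (with respect to $\mathrm{ad}(\mathfrak h)$), and $\lambda\in\mathfrak h^*$. Then the following conditions are equivalent: (1) $P$ annihilates $L(\lambda)$; (2) $pr_{\mathfrak g/\mathfrak h}(p)$ vanishes at $\lambda$ for all $p\in P$; (3) $pr_{\mathfrak g/\mathfrak h}(p)$ vanishes at $\lambda$ for all $p\in P_0$.
   Context: The choice of simple roots gives a triangular decomposition $\mathfrak g=\mathfrak n^+\oplus\mathfrak h\oplus\mathfrak n^-$, where $\mathfrak n^{+}$ (resp. $\mathfrak n^-$) is the sum of the positive (resp. negative) root spaces. By the Poincaré–Birkhoff–Witt theorem $U(\mathfrak g)=(\mathfrak n^-U(\mathfrak g)+U(\mathfrak g)\mathfrak n^+)\oplus U(\mathfrak h)$, and the Harish-Chandra projection $pr_{\mathfrak g/\mathfrak h}:U(\mathfrak g)\to U(\mathfrak h)$ is the projection onto the second summand. $U(\mathfrak h)$ is identified with the algebra of polynomial functions on $\mathfrak h^*$, so its elements may be evaluated at $\lambda\in\mathfrak h^*$. $L(\lambda)$ denotes the simple highest weight $\mathfrak g$-module with highest weight $\lambda$ (no $\rho$-shift): it is generated by a vector $v_\lambda\ne0$ with $\mathfrak n^+v_\lambda=0$ and $hv_\lambda=\lambda(h)v_\lambda$ for $h\in\mathfrak h$. *)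

(* Defs.v *)
From HB Require Import structures.
From mathcomp Require Import all_boot all_order all_algebra.
From mathcomp Require Import boolp classical_sets reals complex.

Set Implicit Arguments.
Unset Strict Implicit.
Unset Printing Implicit Defensive.

Import GRing.Theory.
Local Open Scope ring_scope.
Local Open Scope classical_set_scope.
Local Open Scope quotient_scope.

HB.mixin Record isLieAlgebra (K : fieldType) L of Vector K L := {
  lie : L -> L -> L;
  lie_linearl : forall z, linear (lie^~ z);
  lie_linearr : forall z, linear (lie z);
  liexx : forall x, lie x x = 0;
  lie_jacobi : forall x y z,
    lie x (lie y z) + lie y (lie z x) + lie z (lie x y) = 0
}.

#[short(type="lieAlgType")]
HB.structure Definition LieAlgebra (K : fieldType) :=
  {L of isLieAlgebra K L & Vector K L}.

Section LieSubalgebra.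
Variables (K : fieldType) (g : lieAlgType K).

Record lieSubalg := LieSubalg {
  lsval :> {vspace g};
  lsvalP : forall x y, x \in lsval -> y \in lsval -> lie x y \in lsval
}.

Definition lsub (h : lieSubalg) : Type := subvs_of h.

HB.instance Definition _ (h : lieSubalg) := Vector.on (lsub h).

Section LsubInstance.
Variable h : lieSubalg.
Implicit Types x y z : lsub h.

Definition lsub_lie x y : lsub h := Subvs (lsvalP (subvsP x) (subvsP y)).

Fact lsub_lie_linearl z : linear (lsub_lie^~ z).
Proof. by move=> a x y; apply: val_inj; exact: lie_linearl. Qed.

Fact lsub_lie_linearr z : linear (lsub_lie z).
Proof. by move=> a x y; apply: val_inj; exact: lie_linearr. Qed.

Fact lsub_liexx x : lsub_lie x x = 0.
Proof. by apply: val_inj; exact: liexx. Qed.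

Fact lsub_lie_jacobi x y z :
  lsub_lie x (lsub_lie y z) + lsub_lie y (lsub_lie z x)
    + lsub_lie z (lsub_lie x y) = 0.
Proof. by apply: val_inj; exact: lie_jacobi. Qed.

HB.instance Definition _ := isLieAlgebra.Build K (lsub h)
  lsub_lie_linearl lsub_lie_linearr lsub_liexx lsub_lie_jacobi.

End LsubInstance.

Definition lsub_incl (h : lieSubalg) (x : lsub h) : g := vsval x.

End LieSubalgebra.

Section Reductive.
Variables (K : fieldType) (g : lieAlgType K).

Definition is_ideal (I : {vspace g}) := forall x y, y \in I -> lie x y \in I.

(* By bilinearity, the span of all [x, y] with x in U and y in V. *)
Definition lie_prod (U V : {vspace g}) : {vspace g} :=
  <<[seq lie x y | x <- vbasis U, y <- vbasis V]>>%VS.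

Definition solvable (I : {vspace g}) :=
  exists n, iter n (fun U => lie_prod U U) I = 0%VS.

Definition is_radical (r : {vspace g}) :=
  [/\ is_ideal r, solvable r &
      forall I : {vspace g}, is_ideal I -> solvable I -> (I <= r)%VS].

Definition central (z : g) := forall x, lie x z = 0.

Definition reductive :=
  exists2 r, is_radical r & forall z, z \in r <-> central z.

Definition ad_semisimple (x : g) :=
  exists2 b : seq g, basis_of fullv b &
    forall v, v \in b -> exists c : K, lie x v = c *: v.

(* A Cartan subalgebra of a reductive Lie algebra in characteristic zero is a
   toral subalgebra which coincides with its centralizer. *)
Definition is_cartan (h : lieSubalg g) :=
  [/\ forall x y, x \in h -> y \in h -> lie x y = 0,
      forall x, x \in h -> ad_semisimple x &
      forall x, x \in h <-> (forall y, y \in h -> lie y x = 0)].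

Variable h : lieSubalg g.

Definition dual := 'Hom(lsub h, K^o).

Definition root_space (a : dual) : set g :=
  [set x | forall y : lsub h, lie (lsub_incl y) x = (a y : K) *: x].

Definition is_root (a : dual) := a != 0 /\ exists2 x, root_space a x & x != 0.

Definition nat_comb (D : seq dual) (a : dual) :=
  exists k : 'I_(size D) -> nat, a = \sum_(i < size D) D`_i *+ k i.

Definition simple_system (D : seq dual) :=
  [/\ free D, forall a, a \in D -> is_root a &
      forall a, is_root a -> nat_comb D a \/ nat_comb D (- a)].

Definition positive_root D (a : dual) := is_root a /\ nat_comb D a.
Definition negative_root D (a : dual) := is_root a /\ nat_comb D (- a).

End Reductive.

Definition lspan (K : fieldType) (V : lmodType K) (S : set V) : set V :=
  [set v | exists2 s : seq (K * V), (forall p, p \in s -> S p.2)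
                                  & v = \sum_(p <- s) p.1 *: p.2].

Definition n_pos (K : fieldType) (g : lieAlgType K) (h : lieSubalg g)
    (D : seq (dual h)) : set g :=
  lspan [set x | exists2 a, positive_root D a & root_space a x].

Definition n_neg (K : fieldType) (g : lieAlgType K) (h : lieSubalg g)
    (D : seq (dual h)) : set g :=
  lspan [set x | exists2 a, negative_root D a & root_space a x].

(* U(g) is the associative unital K-algebra presented by the generators x in g,
   and the relations saying that g -> U(g) is linear and that
   x y - y x = [x, y]; this is the quotient of the tensor algebra of g by the
   ideal generated by the x (x) y - y (x) x - [x, y]. *)

Section Enveloping.
Variables (K : fieldType) (g : lieAlgType K).

Inductive uterm : Type :=
  | UGen of g
  | UCst of K
  | UAdd of uterm & uterm
  | UMul of uterm & uterm.

Inductive urel : uterm -> uterm -> Prop :=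
  | urel_refl t : urel t t
  | urel_sym t u : urel t u -> urel u t
  | urel_trans t u v : urel t u -> urel u v -> urel t v
  | urel_add t t' u u' : urel t t' -> urel u u' -> urel (UAdd t u) (UAdd t' u')
  | urel_mul t t' u u' : urel t t' -> urel u u' -> urel (UMul t u) (UMul t' u')
  | urel_addA t u v : urel (UAdd t (UAdd u v)) (UAdd (UAdd t u) v)
  | urel_addC t u : urel (UAdd t u) (UAdd u t)
  | urel_add0 t : urel (UAdd (UCst 0) t) t
  | urel_mulA t u v : urel (UMul t (UMul u v)) (UMul (UMul t u) v)
  | urel_mul1 t : urel (UMul (UCst 1) t) t
  | urel_mulDl t u v : urel (UMul (UAdd t u) v) (UAdd (UMul t v) (UMul u v))
  | urel_mulDr t u v : urel (UMul t (UAdd u v)) (UAdd (UMul t u) (UMul t v))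
  | urel_cstD a b : urel (UCst (a + b)) (UAdd (UCst a) (UCst b))
  | urel_cstM a b : urel (UCst (a * b)) (UMul (UCst a) (UCst b))
  | urel_cstC a t : urel (UMul (UCst a) t) (UMul t (UCst a))
  | urel_mul0 t : urel (UMul (UCst 0) t) (UCst 0)
  | urel_genD x y : urel (UGen (x + y)) (UAdd (UGen x) (UGen y))
  | urel_genZ a x : urel (UGen (a *: x)) (UMul (UCst a) (UGen x))
  | urel_lie x y : urel (UMul (UGen x) (UGen y))
                        (UAdd (UMul (UGen y) (UGen x)) (UGen (lie x y))).

HB.instance Definition _ := gen_eqMixin uterm.
HB.instance Definition _ := gen_choiceMixin uterm.

Definition urelb : rel uterm := fun t u => `[< urel t u >].

Fact urelb_refl : reflexive urelb.
Proof. by move=> t; apply/asboolP; apply: urel_refl. Qed.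

Fact urelb_sym : symmetric urelb.
Proof.
by move=> t u; apply/asboolP/asboolP => /urel_sym.
Qed.

Fact urelb_trans : transitive urelb.
Proof.
move=> u t v /asboolP tu /asboolP uv; apply/asboolP.
exact: urel_trans tu uv.
Qed.

Canonical urel_equiv := EquivRel urelb urelb_refl urelb_sym urelb_trans.

Definition env : Type := {eq_quot urel_equiv}.

HB.instance Definition _ := Choice.on env.
HB.instance Definition _ := EqQuotient.on env.

Lemma env_eqP (t u : uterm) : reflect (\pi_env t = \pi_env u) `[< urel t u >].
Proof. exact: (@eqmodP _ urel_equiv t u). Qed.

Lemma env_eq (t u : uterm) : urel t u -> \pi_env t = \pi_env u.
Proof. by move=> tu; apply/env_eqP/asboolP. Qed.

Lemma urel_repr (t : uterm) : urel (repr (\pi_env t)) t.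
Proof. by apply/asboolP/env_eqP; rewrite reprK. Qed.

Definition env_cst (a : K) : env := \pi_env (UCst a).
Definition env_add (u v : env) : env := \pi_env (UAdd (repr u) (repr v)).
Definition env_mul (u v : env) : env := \pi_env (UMul (repr u) (repr v)).
Definition env_opp (u : env) : env := env_mul (env_cst (- 1)) u.
Definition env_scale (a : K) (u : env) : env := env_mul (env_cst a) u.

Lemma env_addE t u : env_add (\pi_env t) (\pi_env u) = \pi_env (UAdd t u).
Proof. by apply: env_eq; apply: urel_add; apply: urel_repr. Qed.

Lemma env_mulE t u : env_mul (\pi_env t) (\pi_env u) = \pi_env (UMul t u).
Proof. by apply: env_eq; apply: urel_mul; apply: urel_repr. Qed.

Fact env_addA : associative env_add.
Proof.
elim/quotW=> t; elim/quotW=> u; elim/quotW=> v.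
rewrite (env_addE u v) (env_addE t u) !env_addE.
by apply: env_eq; apply: urel_addA.
Qed.

Fact env_addC : commutative env_add.
Proof.
by elim/quotW=> t; elim/quotW=> u; rewrite !env_addE; apply: env_eq; apply: urel_addC.
Qed.

Fact env_add0 : left_id (env_cst 0) env_add.
Proof. by elim/quotW=> t; rewrite env_addE; apply: env_eq; apply: urel_add0. Qed.

Fact env_mulA : associative env_mul.
Proof.
elim/quotW=> t; elim/quotW=> u; elim/quotW=> v.
rewrite (env_mulE u v) (env_mulE t u) !env_mulE.
by apply: env_eq; apply: urel_mulA.
Qed.

Fact env_mul1l : left_id (env_cst 1) env_mul.
Proof. by elim/quotW=> t; rewrite env_mulE; apply: env_eq; apply: urel_mul1. Qed.

Fact env_cstC a u : env_mul (env_cst a) u = env_mul u (env_cst a).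
Proof. by elim/quotW: u => t; rewrite !env_mulE; apply: env_eq; apply: urel_cstC. Qed.

Fact env_mul1r : right_id (env_cst 1) env_mul.
Proof. by move=> u; rewrite -env_cstC env_mul1l. Qed.

Fact env_mulDl : left_distributive env_mul env_add.
Proof.
elim/quotW=> t; elim/quotW=> u; elim/quotW=> v.
rewrite (env_addE t u) (env_mulE t v) (env_mulE u v) env_mulE env_addE.
by apply: env_eq; apply: urel_mulDl.
Qed.

Fact env_mulDr : right_distributive env_mul env_add.
Proof.
elim/quotW=> t; elim/quotW=> u; elim/quotW=> v.
rewrite (env_addE u v) (env_mulE t u) (env_mulE t v) env_mulE env_addE.
by apply: env_eq; apply: urel_mulDr.
Qed.

Fact env_cstD a b : env_cst (a + b) = env_add (env_cst a) (env_cst b).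
Proof. by rewrite env_addE; apply: env_eq; apply: urel_cstD. Qed.

Fact env_cstM a b : env_cst (a * b) = env_mul (env_cst a) (env_cst b).
Proof. by rewrite env_mulE; apply: env_eq; apply: urel_cstM. Qed.

Fact env_mul0 u : env_mul (env_cst 0) u = env_cst 0.
Proof. by elim/quotW: u => t; rewrite env_mulE; apply: env_eq; apply: urel_mul0. Qed.

Fact env_addN : left_inverse (env_cst 0) env_opp env_add.
Proof.
move=> u; rewrite -{2}[u]env_mul1l -env_mulDl -env_cstD addNr.
exact: env_mul0.
Qed.

HB.instance Definition _ :=
  GRing.isZmodule.Build env env_addA env_addC env_add0 env_addN.

Fixpoint uterm_eval (A : algType K) (f : g -> A) (t : uterm) : A :=
  match t with
  | UGen x => f x
  | UCst a => a%:A
  | UAdd t u => uterm_eval f t + uterm_eval f u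
  | UMul t u => uterm_eval f t * uterm_eval f u
  end.

Definition lie_hom (A : algType K) (f : g -> A) :=
  linear f /\ forall x y, f (lie x y) = f x * f y - f y * f x.

Lemma uterm_eval_rel (A : algType K) (f : g -> A) t u :
  lie_hom f -> urel t u -> uterm_eval f t = uterm_eval f u.
Proof.
move=> [flin flie]; elim=> //= {t u}.
- by move=> t u v _ -> _ ->.
- by move=> t t' u u' _ -> _ ->.
- by move=> t t' u u' _ -> _ ->.
- by move=> *; rewrite addrA.
- by move=> *; rewrite addrC.
- by move=> *; rewrite scale0r add0r.
- by move=> *; rewrite mulrA.
- by move=> *; rewrite scale1r mul1r.
- by move=> *; rewrite mulrDl.
- by move=> *; rewrite mulrDr.
- by move=> *; rewrite scalerDl.
- by move=> *; rewrite -scalerAl mul1r scalerA.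
- by move=> *; rewrite -scalerAl mul1r -scalerAr mulr1.
- by move=> *; rewrite scale0r mul0r.
- by move=> x y; rewrite -[x]scale1r flin !scale1r.
- move=> a x; have f0 : f 0 = 0.
    by have := flin (-1) 0 0; rewrite scaler0 addr0 scaleN1r addNr.
  by rewrite -[a *: x]addr0 flin f0 addr0 -scalerAl mul1r.
- by move=> x y; rewrite flie addrC subrK.
Qed.

Fact env_oner_neq0 : env_cst 1 != env_cst 0.
Proof.
apply/eqP => /env_eqP/asboolP.
have f0 : lie_hom (fun _ : g => 0 : K^o).
  by split=> [a x y|x y]; rewrite ?scaler0 ?addr0 ?mulr0 ?subr0.
move=> /(uterm_eval_rel f0) /=; rewrite scale1r scale0r => /eqP.
by rewrite oner_eq0.
Qed.

HB.instance Definition _ := GRing.Zmodule_isNzRing.Build env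
  env_mulA env_mul1l env_mul1r env_mulDl env_mulDr env_oner_neq0.

Fact env_scaleA a b u : env_scale a (env_scale b u) = env_scale (a * b) u.
Proof. by rewrite /env_scale env_mulA env_cstM. Qed.

Fact env_scaleDr : right_distributive env_scale +%R.
Proof. by move=> a u v; apply: env_mulDr. Qed.

Fact env_scaleDl u : {morph env_scale^~ u : a b / a + b}.
Proof. by move=> a b; rewrite /env_scale env_cstD; apply: env_mulDl. Qed.

HB.instance Definition _ := GRing.Zmodule_isLmodule.Build K env
  env_scaleA env_mul1l env_scaleDr env_scaleDl.

Fact env_scaleAl a (u v : env) : a *: (u * v) = (a *: u) * v.
Proof. exact: env_mulA. Qed.

HB.instance Definition _ := GRing.Lmodule_isLalgebra.Build K env env_scaleAl.

Fact env_scaleAr a (u v : env) : a *: (u * v) = u * (a *: v).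
Proof.
rewrite env_scaleAl; change (env_mul (env_scale a u) v
                             = env_mul u (env_scale a v)).
by rewrite /env_scale env_cstC env_mulA.
Qed.

HB.instance Definition _ := GRing.Lalgebra_isAlgebra.Build K env env_scaleAr.

Definition env_in (x : g) : env := \pi_env (UGen x).

Lemma env_in_lie_hom : lie_hom env_in.
Proof.
split=> [a x y|x y].
  transitivity (env_add (env_mul (env_cst a) (env_in x)) (env_in y)) => //.
  rewrite env_mulE env_addE; apply: env_eq.
  apply: urel_trans (urel_genD _ _) _.
  exact: urel_add (urel_genZ _ _) (urel_refl _).
apply/eqP; rewrite eq_sym subr_eq addrC; apply/eqP.
transitivity (env_mul (env_in x) (env_in y)) => //.
transitivity (env_add (env_mul (env_in y) (env_in x)) (env_in (lie x y))) => //.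
rewrite (env_mulE (UGen x) (UGen y)) (env_mulE (UGen y) (UGen x)).
rewrite (env_addE (UMul (UGen y) (UGen x)) (UGen (lie x y))).
by apply: env_eq; apply: urel_lie.
Qed.

(* The algebra morphism U(g) -> A extending f : g -> A, when f is a Lie algebra
   homomorphism (see the lemmas below); junk otherwise. *)
Definition env_lift (A : algType K) (f : g -> A) (u : env) : A :=
  uterm_eval f (repr u).

Section Lift.
Variables (A : algType K) (f : g -> A).
Hypothesis fL : lie_hom f.

Lemma env_liftE t : env_lift f (\pi_env t) = uterm_eval f t.
Proof. exact: uterm_eval_rel fL (urel_repr t). Qed.

Lemma env_lift_in x : env_lift f (env_in x) = f x.
Proof. exact: env_liftE. Qed.

Lemma env_lift_linear : linear (env_lift f).
Proof.
move=> a; elim/quotW=> t; elim/quotW=> u.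
transitivity (env_lift f (\pi_env (UAdd (UMul (UCst a) t) u))).
  by congr env_lift; rewrite -env_addE -env_mulE.
by rewrite !env_liftE /= -scalerAl mul1r.
Qed.

Lemma env_liftM : {morph env_lift f : u v / u * v}.
Proof.
elim/quotW=> t; elim/quotW=> u.
transitivity (env_lift f (\pi_env (UMul t u))).
  by congr env_lift; rewrite -env_mulE.
by rewrite !env_liftE.
Qed.

Lemma env_lift1 : env_lift f 1 = 1.
Proof. by rewrite [LHS]env_liftE /= scale1r. Qed.

Lemma env_lift_uniq (F : {lrmorphism env -> A}) :
  (forall x, F (env_in x) = f x) -> F =1 env_lift f.
Proof.
move=> Ff; elim/quotW=> t; rewrite env_liftE; elim: t => //= [a|t IHt u IHu|t IHt u IHu].
- rewrite -[RHS](_ : F (a *: 1) = _); last by rewrite linearZ /= rmorph1.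
  congr (F _); exact: (esym (env_mul1r (env_cst a))).
- by rewrite -IHt -IHu -rmorphD; congr (F _); exact: (esym (env_addE t u)).
- by rewrite -IHt -IHu -rmorphM; congr (F _); exact: (esym (env_mulE t u)).
Qed.

End Lift.

End Enveloping.

Arguments env_in {K g} x.

Section HarishChandra.
Variables (K : fieldType) (g : lieAlgType K) (h : lieSubalg g).

(* The canonical algebra morphism U(h) -> U(g), injective by PBW. *)
Definition env_incl : env (lsub h) -> env g :=
  env_lift (fun y : lsub h => env_in (lsub_incl y)).

Variable D : seq (dual h).

Definition hc_kernel : set (env g) :=
  [set u + v | u in lspan [set env_in y * w | y in n_neg D & w in setT]
             & v in lspan [set w * env_in x | w in setT & x in n_pos D]].

(* By PBW, there is exactly one q in U(h) such that u - q lies in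
   n^- U(g) + U(g) n^+; the default value 0 is never used. *)
Definition hc_pr (u : env g) : env (lsub h) :=
  xget 0 [set q | hc_kernel (u - env_incl q)].

(* The value at l of the polynomial function on h^* attached to q. As h is
   abelian, the linear form l extends to an algebra morphism U(h) = S(h) -> K. *)
Definition hc_eval (q : env (lsub h)) (l : dual h) : K :=
  env_lift (A := K^o) l q.

Definition ad_invariant (P : {pred env g}) :=
  forall x p, p \in P -> env_in x * p - p * env_in x \in P.

Definition zero_weight_space (P : {pred env g}) : set (env g) :=
  [set p | p \in P /\
     forall y : lsub h,
       env_in (lsub_incl y) * p - p * env_in (lsub_incl y) = 0].

(* A g-module is encoded as a module over U(g): x in g acts as env_in x and a
   scalar a as a%:A. *)
Definition highest_weight_module (l : dual h) (L : lmodType (env g)) :=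
  exists v : L,
    [/\ v != 0,
        forall x, n_pos D x -> env_in x *: v = 0,
        forall y : lsub h, env_in (lsub_incl y) *: v = (l y : K)%:A *: v &
        forall w : L, exists u : env g, w = u *: v].

End HarishChandra.

Definition simple_module (A : nzRingType) (L : lmodType A) :=
  (exists v : L, v != 0) /\
  forall W : {pred L}, submod_closed W ->
    (forall v, v \in W -> v = 0) \/ (forall v, v \in W).

Definition annihilates (A : nzRingType) (P : {pred A}) (L : lmodType A) :=
  forall p, p \in P -> forall v : L, p *: v = 0.

(* Main.v *)
Require Import Defs.
From HB Require Import structures.
From mathcomp Require Import all_boot all_order all_algebra.
From mathcomp Require Import boolp classical_sets reals complex.

Set Implicit Arguments.
Unset Strict Implicit.
Unset Printing Implicit Defensive.

Import GRing.Theory.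
Local Open Scope ring_scope.
Local Open Scope complex_scope.
Local Open Scope classical_set_scope.

(** Let [v] be the highest weight vector of [L] and [low] the span of the weight
    vectors of weight different from [lambda].  Since [L] is spanned by weight
    vectors of weight [lambda - (sum of simple roots)], [n^- L] lies in [low],
    while [v] does not.  As [p - pr p] lies in [n^- U + U n^+], this gives
    [p v = (pr p)(lambda) v] modulo [low], so that [(pr p)(lambda) = 0] if and
    only if [p v] lies in [low].  In particular, only the spanning half of the
    Poincare-Birkhoff-Witt theorem is needed.
    (2) => (1): [U = n^- U + U(b)] with [b = h + n^+], and [U(b) P v] is contained
    in [P v] as [P] is ad-invariant; hence [U P v] lies in [low], so it is a
    proper submodule of [L], which is zero.
    (3) => (2): [P] contains the zero weight component of each of its elements
    [p], and the other weight components map [v] into [low]. *)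

(** * Spans and weight vectors *)

Section Span.
Variables (K : fieldType) (V : lmodType K).
Implicit Types S Z : set V.

Definition lin_closed Z := Z 0 /\ forall a u v, Z u -> Z v -> Z (a *: u + v).

Lemma lin_closedD Z u v : lin_closed Z -> Z u -> Z v -> Z (u + v).
Proof. by move=> [_ ZD] Zu Zv; rewrite -[u]scale1r; apply: ZD. Qed.

Lemma lin_closedZ Z a u : lin_closed Z -> Z u -> Z (a *: u).
Proof. by move=> [Z0 ZD] Zu; rewrite -[_ *: _]addr0; apply: ZD. Qed.

Lemma lin_closedB Z u v : lin_closed Z -> Z u -> Z v -> Z (u - v).
Proof. by move=> [_ ZD] Zu Zv; rewrite addrC -scaleN1r; apply: ZD. Qed.

Lemma lspan_closed S : lin_closed (lspan S).
Proof.
split=> [|a _ _ [s sS ->] [t tS ->]]; first by exists [::]; rewrite ?big_nil.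
exists ([seq (a * p.1, p.2) | p <- s] ++ t).
  by move=> p; rewrite mem_cat => /orP[/mapP[q /sS Sq ->]|/tS].
rewrite big_cat big_map scaler_sumr; congr (_ + _).
by apply: eq_bigr => p _; rewrite scalerA.
Qed.

Lemma lspan_sub S x : S x -> lspan S x.
Proof.
move=> Sx; exists [:: (1, x)]; first by move=> p; rewrite inE => /eqP->.
by rewrite big_seq1 scale1r.
Qed.

Lemma lspan_min S Z : lin_closed Z -> S `<=` Z -> lspan S `<=` Z.
Proof.
move=> Zl SZ _ [s sS ->]; elim: s sS => [|p s IH] sS; first by rewrite big_nil; case: Zl.
rewrite big_cons; apply: Zl.2; first by apply/SZ/sS; rewrite mem_head.
by apply: IH => q qs; apply: sS; rewrite inE qs orbT.
Qed.

Lemma lspanS S S' : S `<=` S' -> lspan S `<=` lspan S'.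
Proof.
by move=> SS'; apply: lspan_min (lspan_closed _) _ => x /SS'; apply: lspan_sub.
Qed.

End Span.

(** With [lspan_min], this reduces a property of the image of a span under a linear map to its
    generators; nested uses handle bilinear expressions. *)
Lemma linear_preim (K : fieldType) (V W : lmodType K) (f : V -> W) (Z : set W) :
  linear f -> lin_closed Z -> lin_closed (f @^-1` Z).
Proof.
move=> fL [Z0 ZD]; split=> [|a u v Zu Zv] /=; last by rewrite fL; apply: ZD.
have := fL (-1) 0 0; rewrite scaler0 addr0 scaleN1r addNr.
by rewrite /preimage /= => ->.
Qed.

Section Weights.
Variables (K : fieldType) (T : Type) (V : lmodType K) (op : T -> V -> V).
Hypothesis op_linear : forall y, linear (op y).

(** The index type [T] is arbitrary, so that one definition covers a single operator ([T = unit]),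
    $\mathrm{ad}(\mathfrak h)$ on $U(\mathfrak g)$, and $\mathfrak h$ acting on $L$. *)
Definition weight_vec (mu : T -> K) : set V :=
  [set w | forall y, op y w = mu y *: w].

Definition off_weight (lam : T -> K) : set V :=
  [set w | exists2 mu, weight_vec mu w & exists y, mu y <> lam y].

Lemma opZ y a w : op y (a *: w) = a *: op y w.
Proof.
have op0 : op y 0 = 0.
  by have := op_linear y (-1) 0 0; rewrite scaler0 addr0 scaleN1r addNr.
by rewrite -[a *: w]addr0 op_linear op0 addr0.
Qed.

Lemma weight_vec_closed mu : lin_closed (weight_vec mu).
Proof.
split=> [y|a u v wu wv y]; first by rewrite -[0](scaler0 _ 0) opZ !scale0r scaler0.
by rewrite op_linear wu wv scalerDr !scalerA mulrC.
Qed.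

Variable Z : set V.
Hypothesis Z_closed : lin_closed Z.
Hypothesis Z_stable : forall y z, Z z -> Z (op y z).

(* Applying [op y - mu y] kills the summands of weight [mu], and multiplies [z]
   by the nonzero scalar [lam y - mu y]. *)
Lemma weight_component lam z r :
  weight_vec lam z -> lspan (off_weight lam) r -> Z (z + r) -> Z z.
Proof.
move=> zw [s sw ->{r}].
have [n] := ubnP (size s); elim: n s sw z zw => // n IH [|p s] sw z zw.
  by rewrite big_nil addr0.
rewrite /= ltnS big_cons => sn Zr.
have [mu pw [y neq]] := sw p (mem_head _ _).
have dn0 : lam y - mu y != 0 by rewrite subr_eq0; apply/eqP => /esym.
suff : Z ((lam y - mu y) *: z).
  by move=> /(lin_closedZ (lam y - mu y)^-1 Z_closed); rewrite scalerA mulVf ?scale1r.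
pose T_ w := op y w - mu y *: w.
have T_lin : linear T_.
  by move=> a u v; rewrite /T_ op_linear scalerBr scalerDr opprD addrACA !scalerA mulrC.
have ZT : Z (T_ (z + (p.1 *: p.2 + \sum_(q <- s) q.1 *: q.2))).
  by apply: lin_closedB => //; [apply: Z_stable | apply: lin_closedZ].
(* [T_] only rescales the other summands, so the induction hypothesis applies to the list without
   [p]. *)
apply: (IH [seq (q.1, T_ q.2) | q <- s]); last first.
- rewrite big_map /=; move: ZT.
  have TD u v : T_ (u + v) = T_ u + T_ v.
    by have := T_lin 1 u v; rewrite !scale1r.
  have T0 : T_ 0 = 0 by have := T_lin (-1) 0 0; rewrite scaler0 addr0 scaleN1r addNr.
  have TZ a u : T_ (a *: u) = a *: T_ u.
    by have := T_lin a u 0; rewrite T0 !addr0.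
  rewrite !TD TZ [T_ z]/T_ zw -scalerBl [T_ p.2]/T_ pw subrr scaler0 add0r.
  rewrite (big_morph T_ TD T0); congr (Z (_ + _)).
  by apply: eq_bigr => q _; rewrite TZ.
- by rewrite size_map.
- exact: lin_closedZ (weight_vec_closed _) zw.
move=> _ /mapP[q qs ->] /=.
have [nu qw nunl] : off_weight lam q.2 by apply: sw; rewrite inE qs orbT.
exists nu => //; rewrite /T_ qw -scalerBl.
exact: lin_closedZ (weight_vec_closed _) qw.
Qed.

End Weights.

(** A diagonalizable operator stays diagonalizable on a stable subspace: the summands of [z] sharing
    the eigenvalue of the first one add up to an element of [Z] by [weight_component], and the
    remaining ones are fewer. *)
Lemma stable_eigen_span (K : fieldType) (V : lmodType K) (f : V -> V) (Z : set V) :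
  linear f -> lin_closed Z -> (forall z, Z z -> Z (f z)) ->
  forall z, Z z -> lspan [set w | exists c, f w = c *: w] z ->
  lspan [set w | Z w /\ exists c, f w = c *: w] z.
Proof.
move=> f_lin Zc Zf z Zz [s sw zE].
have [n] := ubnP (size s); elim: n s sw z Zz zE => // n IH [|p s] sw z Zz zE.
  by rewrite zE big_nil => _; apply: (lspan_closed _).1.
move=> /= sn; have [c pc] := sw p (mem_head _ _).
pose t := p :: s; pose ec (q : K * V) := f q.2 == c *: q.2.
pose op (_ : unit) := f.
have op_lin y : linear (op y) by [].
(* All summands of eigenvalue [c] are collected, so each leftover one has an eigenvalue different
   from [c], as [weight_component] requires. *)
pose zc := \sum_(q <- t | ec q) q.1 *: q.2.
have zcE : z = zc + \sum_(q <- t | ~~ ec q) q.1 *: q.2 by rewrite zE (bigID ec).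
have sumE (P : pred (K * V)) (F : K * V -> V) :
    \sum_(q <- t | P q) F q = \sum_(q <- filter P t) F q by rewrite big_filter.
have zcw : weight_vec op (fun=> c) zc.
  apply: (lspan_min (S := weight_vec op (fun=> c))) => //.
    exact: weight_vec_closed.
  exists (filter ec t); last by rewrite -sumE.
  by move=> q; rewrite mem_filter => /andP[/eqP qe _] y.
have Zzc : Z zc.
  apply: (weight_component op_lin Zc (fun=> Zf) zcw
    (r := \sum_(q <- t | ~~ ec q) q.1 *: q.2)); last by rewrite -zcE.
  exists (filter (predC ec) t); last by rewrite sumE.
  move=> q; rewrite mem_filter => /andP[/= qe /sw[d qd]].
  exists (fun=> d); first by move=> y.
  by exists tt => dc; move: qe; rewrite /ec qd dc eqxx.
rewrite zcE; apply: lin_closedD; first exact: lspan_closed.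
  by apply: lspan_sub; split=> //; exists c; apply: zcw tt.
apply: (IH (filter (predC ec) t)); last 2 first.
- by rewrite sumE.
- move: sn; rewrite ltnS; apply: leq_trans; rewrite size_filter /= {1}/ec pc eqxx /=.
  by rewrite add0n ltnS count_size.
- by move=> q; rewrite mem_filter => /andP[_ /sw].
have -> : \sum_(q <- t | ~~ ec q) q.1 *: q.2 = z - zc by rewrite zcE addrC addKr.
exact: lin_closedB.
Qed.

(** * Root space decomposition *)

Section LieTheory.
Variables (K : fieldType) (g : lieAlgType K).
Implicit Types x y z : g.

Lemma lie0r x : lie x 0 = 0.
Proof. by have := lie_linearr x (-1) 0 0; rewrite scaler0 addr0 scaleN1r addNr. Qed.

Lemma lie0l x : lie 0 x = 0.
Proof. by have := lie_linearl x (-1) 0 0; rewrite scaler0 addr0 scaleN1r addNr. Qed.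

Lemma lieDl x y z : lie (x + y) z = lie x z + lie y z.
Proof. by have := lie_linearl z 1 x y; rewrite !scale1r. Qed.

Lemma lieDr x y z : lie x (y + z) = lie x y + lie x z.
Proof. by have := lie_linearr x 1 y z; rewrite !scale1r. Qed.

Lemma lieZl a x y : lie (a *: x) y = a *: lie x y.
Proof. by have := lie_linearl y a x 0; rewrite lie0l !addr0. Qed.

Lemma lieZr a x y : lie x (a *: y) = a *: lie x y.
Proof. by have := lie_linearr x a y 0; rewrite lie0r !addr0. Qed.

Lemma lieC x y : lie x y = - lie y x.
Proof.
have := liexx (x + y); rewrite lieDl !lieDr !liexx add0r addr0 => /eqP.
by rewrite addr_eq0 => /eqP.
Qed.

Lemma lie_commute x y z : lie x y = 0 -> lie x (lie y z) = lie y (lie x z).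
Proof.
move=> xy0; have := lie_jacobi x y z; rewrite xy0 lie0r addr0 => /eqP.
rewrite addr_eq0 => /eqP ->; rewrite (lieC z x) -[X in lie y X]scaleN1r lieZr.
by rewrite scaleN1r opprK.
Qed.

Lemma ad_eigen_span x : ad_semisimple x ->
  forall z, lspan [set w | exists c, lie x w = c *: w] z.
Proof.
move=> [b bb bx] z; have zb : z \in <<in_tuple b>>%VS.
  by rewrite (span_basis bb) memvf.
rewrite (coord_span zb).
exists [seq (coord (in_tuple b) i z, b`_i) | i <- enum 'I_(size b)].
  by move=> _ /mapP[i _ ->] /=; apply/bx/mem_nth.
by rewrite big_map big_enum.
Qed.

Variable h : lieSubalg g.

Fact lsub_incl_linear : linear (@lsub_incl K g h).
Proof. exact: linearP. Qed.

HB.instance Definition _ :=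
  GRing.isLinear.Build K (lsub h) g *:%R (@lsub_incl K g h) lsub_incl_linear.

(** Simultaneous diagonalization, one operator at a time: each joint eigenvector for [ys] is split
    under the next operator without leaving its joint eigenspace. *)
Lemma toral_eigen_span :
  (forall x y, x \in h -> y \in h -> lie x y = 0) ->
  (forall x, x \in h -> ad_semisimple x) ->
  forall (ys : seq (lsub h)) x,
  lspan [set e : g | forall y : lsub h, y \in ys -> exists c, lie (lsub_incl y) e = c *: e] x.
Proof.
move=> h_ab h_ss; elim=> [|y0 ys IH] x; first by apply: lspan_sub.
apply: (lspan_min (lspan_closed _) _ (IH x)) => e e_ys.
(* The joint eigenspace of [e]; it is stable under [lie (lsub_incl y0)] because $\mathfrak h$ is
   abelian. *)
pose Z : set g := [set z : g | forall y : lsub h, y \in ys -> forall c,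
  lie (lsub_incl y) e = c *: e -> lie (lsub_incl y) z = c *: z].
have Zc : lin_closed Z.
  split=> [y _ c _|a u v Zu Zv y yys c ec]; first by rewrite lie0r scaler0.
  by rewrite lieDr lieZr (Zu y yys c ec) (Zv y yys c ec) scalerDr !scalerA mulrC.
have Zf z : Z z -> Z (lie (lsub_incl y0) z).
  move=> Zz y yys c ec; rewrite lie_commute ?(Zz y yys c ec) ?lieZr //.
  by apply: h_ab; apply: subvsP.
have Ze : Z e by move=> y.
have := stable_eigen_span (@lie_linearr K g _) Zc Zf Ze (ad_eigen_span (h_ss _ (subvsP y0)) e).
apply: lspanS => z [Zz [c zc]] y; rewrite inE => /orP[/eqP->|yys].
  by exists c.
by have [d ed] := e_ys y yys; exists d; apply: Zz.
Qed.

(** Joint eigenvectors for a basis of $\mathfrak h$ are eigenvectors for all of $\mathfrak h$, and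
    the eigenvalue of a nonzero one depends linearly on the element of $\mathfrak h$, so it is a
    form in $\mathfrak h^*$. *)
Lemma root_space_span :
  (forall x y, x \in h -> y \in h -> lie x y = 0) ->
  (forall x, x \in h -> ad_semisimple x) ->
  forall x, lspan [set e | exists a : dual h, root_space a e] x.
Proof.
move=> h_ab h_ss x.
apply: lspanS (toral_eigen_span h_ab h_ss (vbasis {:lsub h}) x) => e e_b.
have [->|en0] := eqVneq e 0.
  by exists 0 => y; rewrite lie0r scaler0.
have /choice[c cE] (y : lsub h) : exists c, lie (lsub_incl y) e = c *: e.
  have yb : y \in <<vbasis {:lsub h}>>%VS by rewrite (span_basis (vbasisP _)) memvf.
  rewrite (coord_span yb); elim/big_ind: _ => [|u v [a ua] [b vb]|i _].
  - by exists 0; rewrite scale0r linear0 lie0l.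
  - by exists (a + b); rewrite linearD lieDl ua vb scalerDl.
  have [|a ia] := e_b (vbasis {:lsub h})`_i; first by rewrite mem_nth ?size_tuple.
  by eexists; rewrite linearZ lieZl ia scalerA.
have c_lin : linear (c : lsub h -> K^o).
  move=> a u v; apply/eqP; rewrite -subr_eq0.
  have := subrr (c (a *: u + v) *: e); rewrite -{1}cE lsub_incl_linear lieDl lieZl.
  rewrite !cE scalerA -scalerDl -scalerBl => /eqP.
  by rewrite scaler_eq0 (negPf en0) orbF -opprB oppr_eq0.
pose f : {linear lsub h -> K^o} :=
  HB.pack c (GRing.isLinear.Build K (lsub h) K^o *:%R c c_lin).
by exists (linfun f) => y; rewrite lfunE.
Qed.

End LieTheory.

(** * Triangular decomposition of $\mathfrak g$ *)

Section Triangular.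
Variables (K : fieldType) (g : lieAlgType K) (h : lieSubalg g) (D : seq (dual h)).

(** The root spaces span $\mathfrak g$. A vector of weight zero centralizes $\mathfrak h$, so it
    lies in the Cartan subalgebra $\mathfrak h$; the weight of any other nonzero generator is a
    root, positive or negative by the choice of simple roots. *)
Lemma triangular_decomposition : is_cartan h -> simple_system D ->
  forall x, exists n (y : lsub h) m, [/\ n_neg D n, n_pos D m & x = n + lsub_incl y + m].
Proof.
move=> [h_ab h_ss h_cent] [_ _ D_sgn] x.
pose Z : set g := [set x | exists n (y : lsub h) m,
  [/\ n_neg D n, n_pos D m & x = n + lsub_incl y + m]].
have Zc : lin_closed Z.
  split=> [|a _ _ [n [y [m [nn mp ->]]]] [n' [y' [m' [nn' mp' ->]]]]].
    exists 0, 0, 0; split; rewrite ?linear0 ?addr0 //.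
    - exact: (lspan_closed _).1.
    - exact: (lspan_closed _).1.
  exists (a *: n + n'), (a *: y + y'), (a *: m + m'); split.
  - exact: (lspan_closed _).2.
  - exact: (lspan_closed _).2.
  by rewrite linearP !scalerDr addrACA; congr (_ + _); rewrite addrACA.
apply: (lspan_min Zc _ (root_space_span h_ab h_ss x)) => e [a ea].
have [a0|an0] := eqVneq a 0.
  have eh : e \in h.
    apply/h_cent => y yh; have := ea (Subvs yh).
    by rewrite a0 lfunE scale0r.
  exists 0, (Subvs eh), 0; split; rewrite ?add0r ?addr0 //.
  - exact: (lspan_closed _).1.
  - exact: (lspan_closed _).1.
have [->|en0] := eqVneq e 0; first exact: Zc.1.
have a_root : is_root a by split=> //; exists e.
case: (D_sgn a a_root) => a_sgn.
- exists 0, 0, e; split; rewrite ?linear0 ?add0r //.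
  + exact: (lspan_closed _).1.
  + by apply: lspan_sub; exists a.
- exists e, 0, 0; split; rewrite ?linear0 ?addr0 //.
  + by apply: lspan_sub; exists a.
  + exact: (lspan_closed _).1.
Qed.

Lemma n_pos_stable (y : lsub h) x : n_pos D x -> n_pos D (lie (lsub_incl y) x).
Proof.
apply: (lspan_min (linear_preim (@lie_linearr K g _) (lspan_closed _))) => e [a ap ea] /=.
by rewrite /preimage /= ea; apply: lin_closedZ (lspan_closed _) _; apply: lspan_sub; exists a.
Qed.

End Triangular.

(** * Decompositions of the enveloping algebra *)

Section EnvTheory.
Variables (K : fieldType) (g : lieAlgType K).
Implicit Types (x y : g) (u v w : env g).

Lemma env_ind (Q : env g -> Prop) :
  (forall a, Q a%:A) -> (forall x, Q (env_in x)) ->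
  (forall u v, Q u -> Q v -> Q (u + v)) -> (forall u v, Q u -> Q v -> Q (u * v)) ->
  forall u, Q u.
Proof.
move=> Qc Qg QD QM; elim/quotW; elim=> [x|a|t Qt u Qu|t Qt u Qu]; first exact: Qg.
- have := Qc a; rewrite (_ : a%:A = env_cst g a) //; exact: env_mul1r.
- have := QD _ _ Qt Qu.
  by rewrite [_ + _](_ : _ = \pi_(env g)%qT (UAdd t u)) //; exact: env_addE.
- have := QM _ _ Qt Qu.
  by rewrite [_ * _](_ : _ = \pi_(env g)%qT (UMul t u)) //; exact: env_mulE.
Qed.

Lemma env_in_linear : linear (@env_in K g).
Proof. exact: (env_in_lie_hom g).1. Qed.

HB.instance Definition _ :=
  GRing.isLinear.Build K g (env g) *:%R (@env_in K g) env_in_linear.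

Lemma env_in_lie x y : env_in (lie x y) = env_in x * env_in y - env_in y * env_in x.
Proof. exact: (env_in_lie_hom g).2. Qed.

Lemma env_in_swap x y : env_in x * env_in y = env_in y * env_in x + env_in (lie x y).
Proof. by rewrite env_in_lie addrC subrK. Qed.

End EnvTheory.

Section EnvDecomposition.
Variables (K : fieldType) (g : lieAlgType K) (h : lieSubalg g) (D : seq (dual h)).
Implicit Types (x : g) (y : lsub h) (u v w : env g).
Hypothesis g_dec :
  forall x, exists n (y : lsub h) m, [/\ n_neg D n, n_pos D m & x = n + lsub_incl y + m].

Lemma env_incl_lie_hom : lie_hom (fun y : lsub h => env_in (lsub_incl y)).
Proof.
split=> [a y z|y z]; first by rewrite !linearP.
exact: env_in_lie.
Qed.

Lemma env_incl_in y : env_incl (env_in y) = env_in (lsub_incl y).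
Proof. exact: env_lift_in env_incl_lie_hom _. Qed.

Lemma env_inclM (p q : env (lsub h)) : env_incl (p * q) = env_incl p * env_incl q.
Proof. exact: env_liftM env_incl_lie_hom _ _. Qed.

Fact env_incl_linear : linear (@env_incl K g h).
Proof. exact: env_lift_linear env_incl_lie_hom. Qed.

HB.instance Definition _ :=
  GRing.isLinear.Build K (env (lsub h)) (env g) *:%R (@env_incl K g h) env_incl_linear.

Lemma env_incl_cst a : env_incl (a%:A : env (lsub h)) = a%:A.
Proof. by rewrite linearZ /= /env_incl (env_lift1 env_incl_lie_hom). Qed.

(* The image in U(g) of the enveloping algebra of the Borel subalgebra [h + n^+]. *)
Inductive borel_env : env g -> Prop :=
  | borel_cst a : borel_env a%:A
  | borel_h y : borel_env (env_in (lsub_incl y))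
  | borel_n x : n_pos D x -> borel_env (env_in x)
  | borel_add u v : borel_env u -> borel_env v -> borel_env (u + v)
  | borel_mul u v : borel_env u -> borel_env v -> borel_env (u * v).

Definition left_n : set (env g) :=
  lspan [set env_in y * w | y in n_neg D & w in setT].
Definition right_n : set (env g) :=
  lspan [set w * env_in x | w in setT & x in n_pos D].

Lemma mulr_linear u : linear (fun v => v * u).
Proof. by move=> a v w; rewrite mulrDl scalerAl. Qed.

Lemma mull_linear u : linear (fun v => u * v).
Proof. by move=> a v w; rewrite mulrDr scalerAr. Qed.

Lemma right_nM u w : right_n u -> right_n (w * u).
Proof.
apply: (lspan_min (linear_preim (mull_linear w) (lspan_closed _))).
move=> _ [v _ [x xn <-]]; apply: lspan_sub.
by exists (w * v) => //; exists x => //; rewrite mulrA.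
Qed.

(** Moving $y\in\mathfrak h$ to the left of $x\in\mathfrak n^+$ costs $[x,y]$, which is again in
    $\mathfrak n^+$. *)
Lemma right_n_env_incl u (q : env (lsub h)) : right_n u -> right_n (u * env_incl q).
Proof.
move: u; elim/env_ind: q => [a|y|p q IHp IHq|p q IHp IHq] u un.
- rewrite env_incl_cst -scalerAr mulr1; exact: lin_closedZ (lspan_closed _) un.
- rewrite env_incl_in; move: u un.
  apply: (lspan_min (linear_preim (mulr_linear _) (lspan_closed _))).
  move=> _ [v _ [x xn <-]]; rewrite /preimage /= -mulrA env_in_swap mulrDr mulrA.
  apply: lin_closedD; first exact: lspan_closed.
    by apply: lspan_sub; exists (v * env_in (lsub_incl y)) => //; exists x.
  apply: lspan_sub; exists v => //; exists (lie x (lsub_incl y)) => //.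
  rewrite lieC -scaleN1r; apply: lin_closedZ (lspan_closed _) _.
  exact: n_pos_stable.
- rewrite linearD mulrDr; apply: lin_closedD (lspan_closed _) _ _; [exact: IHp|exact: IHq].
- by rewrite env_inclM mulrA; apply/IHq/IHp.
Qed.

(** Elements of $\mathfrak n^+$ have Cartan part zero. For products, $uv-pq=u(v-q)+(u-p)q$: the
    first term stays in the left ideal $U(\mathfrak g)\mathfrak n^+$, the second does by
    [right_n_env_incl]. *)
Lemma borel_env_dec s : borel_env s -> exists q : env (lsub h), right_n (s - env_incl q).
Proof.
elim=> {s} [a|y|x xn|u v _ [p up] _ [q vq]|u v _ [p up] _ [q vq]].
- by exists a%:A; rewrite env_incl_cst subrr; apply: (lspan_closed _).1.
- by exists (env_in y); rewrite env_incl_in subrr; apply: (lspan_closed _).1.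
- exists 0; rewrite linear0 subr0; apply: lspan_sub.
  by exists 1 => //; exists x => //; rewrite mul1r.
- exists (p + q); rewrite linearD opprD addrACA.
  exact: lin_closedD (lspan_closed _) _ _.
exists (p * q); rewrite env_inclM.
have -> : u * v - env_incl p * env_incl q
        = u * (v - env_incl q) + (u - env_incl p) * env_incl q.
  by rewrite mulrBr mulrBl addrA subrK.
apply: lin_closedD (lspan_closed _) _ _; first exact: right_nM.
exact: right_n_env_incl.
Qed.

Definition env_mon (xs : seq g) : env g := \prod_(x <- xs) env_in x.

Lemma env_mon_span u : lspan (range env_mon) u.
Proof.
have S1 := lspan_closed (range env_mon).
elim/env_ind: u => [a|x|u v|u v Su Sv]; last 2 first.
- exact: lin_closedD.
- apply: (lspan_min (linear_preim (mulr_linear v) S1) _ Su) => _ [xs _ <-].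
  apply: (lspan_min (linear_preim (mull_linear _) S1) _ Sv) => _ [ys _ <-].
  by apply: lspan_sub; exists (xs ++ ys) => //; rewrite /env_mon big_cat.
- apply: lin_closedZ => //; apply: lspan_sub; exists [::] => //.
  by rewrite /env_mon big_nil.
- by apply: lspan_sub; exists [:: x] => //; rewrite /env_mon big_seq1.
Qed.

(** [N] stands for a part of $\mathfrak n^-U(\mathfrak g)$: all of it in [env_dec], the part of
    bounded length in [borel_trunc]. *)
Definition borel_plus (N : set (env g)) : set (env g) :=
  [set u | exists2 s, borel_env s & N (u - s)].

Lemma borel_plus_closed N : lin_closed N -> lin_closed (borel_plus N).
Proof.
move=> Nc; split=> [|a u v [s sb us] [t tb vt]].
  by exists 0; [rewrite -(scale0r 1); apply: borel_cst|rewrite subr0; apply: Nc.1].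
exists (a *: s + t).
  apply: borel_add => //; rewrite -[s]mul1r scalerAl.
  by apply: borel_mul => //; apply: borel_cst.
by rewrite opprD addrACA -scalerBr; apply: Nc.2.
Qed.

(** With [k] the length of the word being rewritten, the factor after the letter from $\mathfrak
    n^-$ is strictly shorter than that word; this drives the inductions on length here and in
    [cone_full]. *)
Definition borel_trunc (k : nat) : set (env g) := borel_plus (lspan
  [set w | exists n xs,
     [/\ n_neg D n, (size xs < k)%N & w = env_in n * env_mon xs]]).

Lemma borel_trunc_closed k : lin_closed (borel_trunc k).
Proof. exact: borel_plus_closed (lspan_closed _). Qed.

(* By induction on the length: if the first letter [b] lies in [h + n^+], then
   [b n w = n b w + [b, n] w], where [[b, n] w] is shorter. *)
Lemma env_mon_borel_trunc xs : borel_trunc (size xs) (env_mon xs).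
Proof.
have [k] := ubnP (size xs); elim: k xs => // k IH [|x xs] /= sk.
  exists 1; first by rewrite -[1]scale1r; apply: borel_cst.
  by rewrite /env_mon big_nil subrr; apply: (lspan_closed _).1.
rewrite ltnS in sk.
have trunc_le i j u : (i <= j)%N -> borel_trunc i u -> borel_trunc j u.
  move=> ij [s sb us]; exists s => //; apply: lspanS us => _ [n [ys [nn ys_i ->]]].
  by exists n, ys; split=> //; apply: leq_trans ij.
have neg_trunc j n ys : n_neg D n -> (size ys < j)%N -> borel_trunc j (env_in n * env_mon ys).
  move=> nn ysj; exists 0; first by rewrite -(scale0r 1); apply: borel_cst.
  by rewrite subr0; apply: lspan_sub; exists n, ys.
have borel_step b : borel_env (env_in b) -> borel_trunc (size xs).+1 (env_in b * env_mon xs).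
  move=> bb; have [s sb xss] := IH xs sk.
  rewrite -(subrK s (env_mon xs)) mulrDr; apply: lin_closedD.
  - exact: borel_trunc_closed.
  - move: xss; apply: (lspan_min (linear_preim (mull_linear (env_in b)) (borel_trunc_closed _))).
    move=> _ [n [ys [nn ys_lt ->]]]; rewrite /preimage /= mulrA env_in_swap mulrDl -mulrA.
    apply: lin_closedD; first exact: borel_trunc_closed.
      rewrite (_ : _ * env_mon ys = env_mon (b :: ys)); last by rewrite /env_mon big_cons.
      exact: neg_trunc.
    rewrite (_ : _ * env_mon ys = env_mon (lie b n :: ys)); last by rewrite /env_mon big_cons.
    (* As [ys] is shorter than [xs], the word [lie b n :: ys] is at most as long as [xs], hence
       covered by the induction hypothesis. *)
    apply: (@trunc_le (size ys).+1); first exact: ltnW.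
    by apply: (IH (lie b n :: ys)); apply: leq_ltn_trans sk.
  exists (env_in b * s); first exact: borel_mul.
  by rewrite subrr; apply: (lspan_closed _).1.
have [n [y [m [nn mp ->]]]] := g_dec x.
rewrite /env_mon big_cons !linearD /= -/(env_mon xs) !mulrDl.
apply: lin_closedD; [exact: borel_trunc_closed| |by apply/borel_step/borel_n].
apply: lin_closedD; [exact: borel_trunc_closed|exact: neg_trunc|].
by apply/borel_step/borel_h.
Qed.

Lemma env_dec u : borel_plus left_n u.
Proof.
have Zc := borel_plus_closed (lspan_closed _ : lin_closed left_n).
apply: (lspan_min Zc _ (env_mon_span u)) => _ [xs _ <-].
have [s sb us] := env_mon_borel_trunc xs; exists s => //.
apply: lspanS us => _ [n [ys [nn _ ->]]].
by exists n => //; exists (env_mon ys).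
Qed.

(** Adding the decompositions of [env_dec] and [borel_env_dec] produces a suitable [q], so [xget]
    returns a valid choice and not its default. *)
Lemma hc_pr_spec u : hc_kernel D (u - env_incl (hc_pr D u)).
Proof.
have [s sb us] := env_dec u; have [q sq] := borel_env_dec sb.
apply: (@xgetPex _ 0 [set q | hc_kernel D (u - env_incl q)]); exists q.
by exists (u - s) => //; exists (s - env_incl q) => //; rewrite addrA subrK.
Qed.

End EnvDecomposition.

(** * Highest weight modules *)

Section Restriction.
Variables (K : fieldType) (A : algType K) (L : lmodType A).

(** [L] has scalars in [A]. Restricting them to [K] along $a\mapsto a\cdot 1$ gives access to the
    linear algebra of spans and weights, while [act] keeps the original action. *)
Definition restrict : Type := L.
HB.instance Definition _ := GRing.Zmodule.on restrict.

Definition restrict_scale (a : K) (w : restrict) : restrict := a%:A *: (w : L).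

Fact restrict_scaleA a b w :
  restrict_scale a (restrict_scale b w) = restrict_scale (a * b) w.
Proof. by rewrite /restrict_scale scalerA -scalerAl mul1r scalerA. Qed.

Fact restrict_scale1 : left_id 1 restrict_scale.
Proof. by move=> w; rewrite /restrict_scale !scale1r. Qed.

Fact restrict_scaleDr : right_distributive restrict_scale +%R.
Proof. by move=> a u v; apply: scalerDr. Qed.

Fact restrict_scaleDl w : {morph restrict_scale^~ w : a b / a + b}.
Proof. by move=> a b; rewrite /restrict_scale scalerDl; apply: scalerDl. Qed.

HB.instance Definition _ := GRing.Zmodule_isLmodule.Build K restrict
  restrict_scaleA restrict_scale1 restrict_scaleDr restrict_scaleDl.

Definition act (u : A) (w : restrict) : restrict := u *: (w : L).

Lemma actM u u' w : act (u * u') w = act u (act u' w).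
Proof. by rewrite /act scalerA. Qed.

Lemma act1 w : act 1 w = w.
Proof. exact: (@scale1r A L w). Qed.

Lemma act_linearl w : linear (act^~ w).
Proof.
move=> a u u'; rewrite /act scalerDl; congr (_ + _).
by rewrite [RHS]scalerA -scalerAl mul1r.
Qed.

Lemma act_linearr u : linear (act u).
Proof.
move=> a w w'; rewrite /act [LHS]scalerDr; congr (_ + _).
by rewrite [LHS]scalerA [RHS]scalerA -scalerAr mulr1 -scalerAl mul1r.
Qed.

Lemma actDl u u' w : act (u + u') w = act u w + act u' w.
Proof. by rewrite /act scalerDl. Qed.

Lemma actBl u u' w : act (u - u') w = act u w - act u' w.
Proof. by rewrite /act scalerBl. Qed.

Lemma actZl a u w : act (a *: u) w = a *: act u w.
Proof. by have := act_linearl w a u 0; rewrite /act scale0r !addr0. Qed.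

Lemma actZr a u w : act u (a *: w) = a *: act u w.
Proof. by have := act_linearr u a w 0; rewrite /act scaler0 !addr0. Qed.

End Restriction.

Section NatComb.
Variables (K : fieldType) (g : lieAlgType K) (h : lieSubalg g) (D : seq (dual h)).

Lemma nat_comb0 : nat_comb D 0.
Proof. by exists (fun=> 0%N); rewrite big1. Qed.

Lemma nat_combD a b : nat_comb D a -> nat_comb D b -> nat_comb D (a + b).
Proof.
move=> [k ->] [m ->]; exists (fun i => k i + m i)%N.
by rewrite -big_split; apply: eq_bigr => i _; rewrite mulrnDr.
Qed.

(** Adding the two expressions gives a relation with coefficients [k i + m i]; these vanish by
    freeness, and in characteristic zero both summands are then zero. *)
Lemma nat_comb_opp_eq0 a : [pchar K] =i pred0 -> free D ->
  nat_comb D a -> nat_comb D (- a) -> a = 0.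
Proof.
move=> /pcharf0P charK freeD [k ka] [m ma].
have /(@freeP _ _ _ (in_tuple D)) D_indep := freeD.
have km0 : \sum_(i < size D) (k i + m i)%:R *: (in_tuple D)`_i = 0.
  rewrite -[RHS](subrr a) {1}ka ma -big_split; apply: eq_bigr => i _.
  by rewrite scaler_nat mulrnDr.
rewrite ka big1 // => i _; have /eqP := D_indep _ km0 i.
by rewrite charK addn_eq0 => /andP[/eqP-> _].
Qed.

Lemma dual_neq (a b : dual h) : a <> b -> exists y, a y <> b y.
Proof.
by move=> ab; apply: contrapT => /forallNP e; apply/ab/lfunP => y; apply: contrapT.
Qed.

End NatComb.

(** * Weights of $\mathrm{ad}(\mathfrak h)$ on $U(\mathfrak g)$ *)

Section AdWeights.
Variables (K : fieldType) (g : lieAlgType K) (h : lieSubalg g).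

Definition ad_h (y : lsub h) (u : env g) : env g :=
  env_in (lsub_incl y) * u - u * env_in (lsub_incl y).

Lemma ad_h_linear y : linear (ad_h y).
Proof.
move=> a u v; rewrite /ad_h mulrDr mulrDl -scalerAl -scalerAr scalerBr.
by rewrite opprD addrACA.
Qed.

(** The root spaces provide weight vectors among the generators, and $\mathrm{ad}(\mathfrak h)$ acts
    by derivations, so weights add up in products. *)
Lemma env_weight_span : is_cartan h -> forall u : env g,
  lspan [set u | exists mu : dual h, weight_vec ad_h mu u] u.
Proof.
move=> [h_ab h_ss _]; set S := (X in lspan X).
have Sc : lin_closed (lspan S) := lspan_closed S.
elim/env_ind => [a|x|u v|u v Su Sv].
- apply/lspan_sub; exists 0 => y.
  by rewrite /ad_h lfunE scale0r -scalerAl -scalerAr mulr1 mul1r subrr.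
- apply: (lspan_min (linear_preim (@env_in_linear K g) Sc) _ (root_space_span h_ab h_ss x)).
  move=> e [a ea]; apply: lspan_sub; exists a => y.
  by rewrite /ad_h -env_in_lie ea linearZ.
- exact: lin_closedD.
apply: (lspan_min (linear_preim (mulr_linear v) Sc) _ Su) => u' [a ua].
apply: (lspan_min (linear_preim (mull_linear u') Sc) _ Sv) => v' [b vb].
apply: lspan_sub; exists (a + b) => y.
have -> : ad_h y (u' * v') = ad_h y u' * v' + u' * ad_h y v'.
  by rewrite /ad_h mulrBl mulrBr !mulrA addrA subrK.
by rewrite ua vb lfunE -scalerAl -scalerAr scalerDl.
Qed.

Lemma env_zero_weight_split : is_cartan h -> forall u : env g, exists z r,
  [/\ u = z + r, weight_vec ad_h (0 : dual h) z &
      lspan (off_weight ad_h (0 : dual h)) r].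
Proof.
move=> hC u; pose Z : set (env g) := [set u | exists z r,
  [/\ u = z + r, weight_vec ad_h (0 : dual h) z &
      lspan (off_weight ad_h (0 : dual h)) r]].
have wc := weight_vec_closed ad_h_linear (0 : dual h).
have oc := lspan_closed (off_weight ad_h (0 : dual h)).
have Zc : lin_closed Z.
  split=> [|a _ _ [z [r [-> zw rw]]] [z' [r' [-> zw' rw']]]].
    by exists 0, 0; split; [rewrite addr0|exact: wc.1|exact: oc.1].
  exists (a *: z + z'), (a *: r + r'); split; [|exact: wc.2|exact: oc.2].
  by rewrite scalerDr addrACA.
apply: (lspan_min Zc _ (env_weight_span hC u)) => {}u [mu uw].
have [mu0|/eqP mun0] := eqVneq mu 0.
  by exists u, 0; split; [rewrite addr0|rewrite -mu0|exact: oc.1].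
exists 0, u; split; [by rewrite add0r|exact: wc.1|apply: lspan_sub].
by exists mu => //; apply: dual_neq.
Qed.

End AdWeights.

(** * Weights of a highest weight module *)

Section HighestWeight.
Variables (K : fieldType) (g : lieAlgType K) (h : lieSubalg g) (D : seq (dual h)).
Variables (lam : dual h) (L : lmodType (env g)).
Hypothesis charK : [pchar K] =i pred0.
Hypothesis hC : is_cartan h.
Hypothesis D_simple : simple_system D.
Local Notation V := (restrict L).
Variable v : V.
Hypothesis v_neq0 : v != 0.
Hypothesis v_pos : forall x, n_pos D x -> act (env_in x) v = 0.
Hypothesis v_wt : forall y : lsub h, act (env_in (lsub_incl y)) v = (lam y : K) *: v.
Hypothesis v_cyclic : forall w : V, exists u : env g, w = act u v.

Let g_dec := triangular_decomposition hC D_simple.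

Definition h_act (y : lsub h) (w : V) : V := act (env_in (lsub_incl y)) w.

Lemma h_act_linear y : linear (h_act y).
Proof. exact: act_linearr. Qed.

Definition low : set V := lspan (off_weight h_act lam).

Let low_closed : lin_closed low := lspan_closed _.

(** Vectors of different weights are independent: [weight_component] for the zero subspace, applied
    to [v + (- v)], would give [v = 0]. *)
Lemma low_hwv : ~ low v.
Proof.
move=> vlow; apply/negP: v_neq0; rewrite negbK; apply/eqP.
apply: (weight_component h_act_linear (Z := [set 0]) _ _ v_wt (r := - v)).
- by split=> [|a _ _ -> ->] //=; rewrite scaler0 addr0.
- by move=> y _ -> /=; rewrite /h_act /act scaler0.
- by rewrite -scaleN1r; apply: lin_closedZ.
- by rewrite subrr.
Qed.

(** Both sides are multiplicative in [q] and agree on $\mathfrak h$. The form [lam] extends to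
    $U(\mathfrak h)$ because brackets in $\mathfrak h$ and commutators in [K] both vanish. *)
Lemma act_env_incl_hwv q : act (env_incl q) v = hc_eval q lam *: v.
Proof.
have lamL : lie_hom (A := K^o) lam.
  split=> [|x y]; first exact: linearP.
  rewrite (_ : lie x y = 0) ?linear0 1?[lam x * _]mulrC ?subrr //.
  by apply: val_inj; have [h_ab _ _] := hC; apply: h_ab; apply: subvsP.
elim/env_ind: q => [a|y|p q IHp IHq|p q IHp IHq].
- rewrite env_incl_cst /hc_eval.
  have /= l0 := env_lift_linear lamL (-1) 0 0; rewrite scaler0 addr0 scaleN1r addNr in l0.
  have := env_lift_linear lamL a 1 0; rewrite (env_lift1 lamL) l0 !addr0 => ->.
  by rewrite [a%:A in RHS]mulr1 actZl act1.
- by rewrite env_incl_in v_wt /hc_eval (env_lift_in lamL).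
- rewrite linearD actDl IHp IHq -scalerDl /hc_eval.
  have := env_lift_linear lamL 1 p q; rewrite !scale1r => -> //.
by rewrite env_inclM actM IHq actZr IHp scalerA /hc_eval (env_liftM lamL) mulrC.
Qed.

Lemma act_right_n_hwv u : right_n D u -> act u v = 0.
Proof.
have Zc : lin_closed [set w : V | w = 0].
  by split=> [|a _ _ -> ->] //=; rewrite scaler0 addr0.
apply: (lspan_min (linear_preim (act_linearl v) Zc)) => _ [w _ [x xn <-]].
by rewrite /preimage /= actM v_pos // /act scaler0.
Qed.

Lemma act_borel_hwv s : borel_env D s -> exists c, act s v = c *: v.
Proof.
move=> /borel_env_dec [q sq]; exists (hc_eval q lam).
by rewrite -act_env_incl_hwv -[LHS]subr0 -(act_right_n_hwv sq) actBl opprB addrC subrK.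
Qed.

Lemma h_act_weight x (a mu : dual h) w :
  root_space a x -> weight_vec h_act mu w -> weight_vec h_act (mu + a) (act (env_in x) w).
Proof.
move=> xa wmu y; rewrite /h_act -actM env_in_swap actDl actM [act _ w]wmu actZr.
by rewrite xa linearZ actZl lfunE scalerDl.
Qed.

(** The weights here are those below [lam] in the usual partial order; [cone_full] shows that they
    exhaust the module. *)
Definition cone : set V :=
  lspan [set w | exists2 mu : dual h, nat_comb D (lam - mu) & weight_vec h_act mu w].

(** Adding a negative root keeps a weight below [lam] and makes it different from [lam]. *)
Lemma cone_neg n w : n_neg D n -> cone w -> cone (act (env_in n) w) /\ low (act (env_in n) w).
Proof.
pose Z : set V := cone `&` low.
have Zc : lin_closed Z.
  have cc : lin_closed cone := lspan_closed _.
  split=> [|a x y [xc xl] [yc yl]]; first by split; [apply: cc.1|apply: low_closed.1].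
  by split; [apply: cc.2|apply: low_closed.2].
have in_lin w' : linear (fun x => act (env_in x) w' : V).
  by move=> a x y; rewrite env_in_linear act_linearl.
move=> + wc; apply: (lspan_min (linear_preim (in_lin w) Zc)) => x [a [a_root a_neg] xa].
apply: (lspan_min (linear_preim (act_linearr (env_in x)) Zc) _ wc) => {wc}w [mu mu_le wmu].
have wt := h_act_weight xa wmu; split; apply: lspan_sub.
  by exists (mu + a) => //; rewrite opprD addrA; apply: nat_combD.
(* If [mu + a = lam], then [a = lam - mu] and [- a] are both nonnegative combinations of simple
   roots, so [a = 0], which is not a root. *)
exists (mu + a) => //; apply: dual_neq => muaE.
have [freeD _ _] := D_simple; case: a_root => /eqP an0 _; apply: an0.
apply: (nat_comb_opp_eq0 charK freeD) => //.
by move: mu_le; rewrite -muaE addrC addrA addNr add0r.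
Qed.

(** Induction on the length of a word applied to [v]: its Borel part multiplies [v] by a scalar, and
    the rest consists of letters from $\mathfrak n^-$ applied to shorter words. *)
Lemma cone_full w : cone w.
Proof.
have cc : lin_closed cone := lspan_closed _.
have cone_v : cone v by apply: lspan_sub; exists lam => //; rewrite subrr; apply: nat_comb0.
have [u ->] := v_cyclic w.
apply: (lspan_min (linear_preim (act_linearl v) cc) _ (env_mon_span u)) => _ [xs _ <-].
rewrite /preimage /=; have [k] := ubnP (size xs); elim: k xs => // k IH xs sk.
have [s sb us] := env_mon_borel_trunc g_dec xs.
rewrite -(subrK s (env_mon xs)) actDl; apply: lin_closedD => //; last first.
  by have [c ->] := act_borel_hwv sb; apply: lin_closedZ.
apply: (lspan_min (linear_preim (act_linearl v) cc) _ us) => _ [n [ys [nn ys_lt ->]]].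
rewrite /preimage /= actM; apply: (cone_neg nn _).1; apply: IH.
by apply: leq_trans ys_lt _; rewrite -ltnS.
Qed.

Lemma low_left_n u w : left_n D u -> low (act u w).
Proof.
apply: (lspan_min (linear_preim (act_linearl w) low_closed)) => _ [n nn [u' _ <-]].
by rewrite /preimage /= actM; apply: (cone_neg nn _).2; apply: cone_full.
Qed.

Lemma low_hc p : low (act p v - hc_eval (hc_pr D p) lam *: v).
Proof.
have [u un [u' un' /esym uE]] := hc_pr_spec g_dec p.
rewrite -act_env_incl_hwv -actBl uE actDl (act_right_n_hwv un') addr0.
exact: low_left_n.
Qed.

Lemma hc_eval_eq0 p : hc_eval (hc_pr D p) lam = 0 <-> low (act p v).
Proof.
split=> [E0|lp]; first by have := low_hc p; rewrite E0 scale0r subr0.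
have [//|/eqP En0] := eqVneq (hc_eval (hc_pr D p) lam) 0; case: low_hwv.
have := lin_closedB low_closed lp (low_hc p); rewrite subKr.
move=> /(lin_closedZ (hc_eval (hc_pr D p) lam)^-1 low_closed).
by rewrite scalerA mulVf ?scale1r //; apply/eqP.
Qed.

(** * Ad-invariant subspaces acting on the highest weight vector *)

Variable P : {pred env g}.
Hypothesis P_closed : @submod_closed K (env g) P.
Hypothesis P_inv : ad_invariant P.

Let P_lin : lin_closed [set p | p \in P].
Proof. by case: P_closed => P0 PD; split=> // a p q; apply: PD. Qed.

Lemma act_swap p x (w : V) : p \in P -> exists2 p', p' \in P &
  act (env_in x * p) w = act (p * env_in x) w + act p' w.
Proof.
move=> pP; exists (env_in x * p - p * env_in x); first exact: P_inv.
by rewrite -actDl addrC subrK.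
Qed.

(** Commuting a generator of the Borel subalgebra past [p] leaves a commutator in [P], and on [v]
    the generator then acts by a scalar, which is zero for $\mathfrak n^+$. *)
Lemma borel_act_P s : borel_env D s -> forall p, p \in P ->
  exists2 p', p' \in P & act (s * p) v = act p' v.
Proof.
elim=> {s} [a|y|x xn|s t _ IHs _ IHt|s t _ IHs _ IHt] p pP.
- by exists (a *: p); [apply: (lin_closedZ a P_lin)|rewrite -scalerAl mul1r].
- have [p' pP' ->] := act_swap (lsub_incl y) v pP.
  exists ((lam y : K) *: p + p'); first exact: P_lin.2.
  by rewrite actM v_wt actZr actDl actZl.
- have [p' pP' ->] := act_swap x v pP.
  by exists p' => //; rewrite actM v_pos // {1}/act scaler0 add0r.
- have [p1 P1 e1] := IHs p pP; have [p2 P2 e2] := IHt p pP.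
  exists (p1 + p2); first exact: (lin_closedD P_lin).
  by rewrite mulrDl !actDl e1 e2.
- have [p1 P1 e1] := IHt p pP; have [p2 P2 e2] := IHs p1 P1.
  by exists p2 => //; rewrite -mulrA actM e1 -actM.
Qed.

Lemma annihilates_hc : simple_module L ->
  annihilates P L <-> (forall p, p \in P -> hc_eval (hc_pr D p) lam = 0).
Proof.
move=> [_ L_simple]; split=> [PL0 p pP|P0 p pP].
  by apply/hc_eval_eq0; rewrite [act p v]PL0 //; apply: low_closed.1.
(* The largest submodule contained in [low] vanishes, and it contains [P v]. *)
pose W : {pred L} := [pred w : L | `[< forall u, low (act u (w : V)) >]].
have W_closed : submod_closed W.
  split=> [|u w w' /asboolP Ww /asboolP Ww']; apply/asboolP => u'.
    by rewrite /act scaler0; apply: low_closed.1.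
  rewrite /act scalerDr scalerA; apply: (lin_closedD low_closed).
    exact: Ww.
  exact: Ww'.
have W0 w : w \in W -> w = 0.
  case: (L_simple W W_closed) => [W0|WT]; first exact: W0.
  by have /asboolP/(_ 1) := WT v; rewrite act1 => /low_hwv.
have Pv0 q : q \in P -> act q v = 0.
  move=> qP; apply: W0; apply/asboolP => u; rewrite -actM.
  have [s sb us] := env_dec g_dec u.
  rewrite -(subrK s u) mulrDl actDl actM; apply: (lin_closedD low_closed).
    exact: low_left_n.
  have [q' qP' ->] := borel_act_P sb qP.
  by apply/hc_eval_eq0/P0.
move=> w; have [u ->] := v_cyclic w.
(* The vectors killed by [P] form a submodule, because $qxw=xqw-[x,q]w$ with $[x,q]\in P$; it
   contains the generator [v]. *)
suff /(_ u v Pv0) : forall u (w : V), (forall q, q \in P -> act q w = 0) ->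
  forall q, q \in P -> act q (act u w) = 0 by apply.
elim/env_ind=> [a|x|t t' IHt IHt'|t t' IHt IHt'] w' w'0 q qP.
- by rewrite actZl actZr act1 w'0 // scaler0.
- have [q' q'P] := act_swap x w' qP; rewrite actM (w'0 q) // (w'0 q') // addr0 -actM.
  by rewrite {1}/act scaler0 => <-.
- by rewrite actDl -[act t w']scale1r (act_linearr q) IHt // IHt' // scaler0 addr0.
- by rewrite actM; apply: IHt => // q1 q1P; apply: IHt'.
Qed.

Lemma hc_zero_weight :
  (forall p, zero_weight_space h P p -> hc_eval (hc_pr D p) lam = 0) ->
  forall p, p \in P -> hc_eval (hc_pr D p) lam = 0.
Proof.
move=> P0 p pP; have [z [r [pE zw rw]]] := env_zero_weight_split hC p.
have zP : z \in P.
  (* Here [weight_component] is applied to [P] itself, as a subspace stable under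
     $\mathrm{ad}(\mathfrak h)$. *)
  apply: (weight_component (@ad_h_linear K g h) P_lin _ zw rw); last by rewrite -pE.
  by move=> y q; apply: P_inv.
apply/hc_eval_eq0; rewrite pE actDl; apply: (lin_closedD low_closed).
  by apply/hc_eval_eq0/P0; split=> // y; have := zw y; rewrite lfunE scale0r.
apply: (lspan_min (linear_preim (act_linearl v) low_closed) _ rw) => q [mu qmu [y muy]].
(* An element of weight [mu] sends [v] to weight [mu + lam], which differs from [lam] at the same
   [y] where [mu] is nonzero. *)
apply: lspan_sub; exists (fun y => mu y + lam y) => [y'|].
  have := qmu y'; rewrite /ad_h => /eqP; rewrite subr_eq => /eqP qE.
  by rewrite /h_act -actM qE actDl (actM q) v_wt actZl actZr scalerDl.
exists y => e; apply: muy; rewrite lfunE.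
by apply: (addIr (lam y : K)); rewrite e add0r.
Qed.

End HighestWeight.

(* [L] is L(lambda), which is determined up to isomorphism. *)
Theorem proposition2p5 (R : realType) (g : lieAlgType R[i])
    (h : lieSubalg g) (D : seq (dual h)) (lambda : dual h)
    (L : lmodType (env g)) (P : {pred env g}) :
  reductive g -> is_cartan h -> simple_system D ->
  highest_weight_module D lambda L -> simple_module L ->
  @submod_closed R[i] (env g) P -> ad_invariant P ->
  (annihilates P L <->
     (forall p, p \in P -> hc_eval (hc_pr D p) lambda = 0)) /\
  ((forall p, p \in P -> hc_eval (hc_pr D p) lambda = 0) <->
     (forall p, zero_weight_space h P p -> hc_eval (hc_pr D p) lambda = 0)).
Proof.
move=> _ hC D_simple [v [v_neq0 v_pos v_wt v_cyclic]] L_simple P_closed P_inv.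
have charK : [pchar R[i]] =i pred0 by apply: Num.Theory.pchar_num.
split.
  exact: (annihilates_hc charK hC D_simple v_neq0 v_pos v_wt v_cyclic P_closed P_inv).
split=> [P0 p [pP _]|]; first exact: P0.
exact: (hc_zero_weight charK hC D_simple v_neq0 v_pos v_wt v_cyclic P_closed P_inv).
Qed.
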